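(* A line of $\mathbb A$ is regular if, and only if, it is an affine regulus (with respect to $W$) in $\mathbb P(K,V)$. In particular, the regular line $\ell(\alpha,\beta)$ (with $\alpha\in\mathrm{Aut}(U)$, $\beta\in\mathrm{End}(U)$) is the image of $\mathcal R_0\setminus\{W\}$ under the projective collineation induced by the linear bijection $V\to V$, $(w,u)\mapsto(w^\alpha+u^\beta,u)$.
   Context: $K$ is a not necessarily commutative field (division ring), $U\neq\{0\}$ is a left $K$-vector space of arbitrary dimension with a fixed basis $(b_i)_{i\in I}$, $V=U\times U$, $W=U\times\{0\}$, and $U$ is identified with $\{0\}\times U$. Linear maps are written as exponents on the right and composed from left to right. $\mathbb P(K,V)$ is the projective space of subspaces of $V$. $\mathcal S:=\{S\le V\mid V=W\oplus S\}$. For $\gamma\in\mathrm{End}(U)$ put $U^{(\gamma,1)}:=\{(u^\gamma,u)\mid u\in U\}$; then $\gamma\mapsto U^{(\gamma,1)}$ is a bijection $\mathrm{End}(U)\to\mathcal S$. For $k\in K$ let $\lambda_k\in\mathrm{End}(U)$ be the $K$-linear map with $b_i\mapsto kb_i$. $\mathbb A$ is the affine space with point set $\mathcal S$ associated with the left $K$-vector space structure $U^{(\gamma,1)}+U^{(\eta,1)}=U^{(\gamma+\eta,1)}$, $k\cdot U^{(\gamma,1)}=U^{(\lambda_k\gamma,1)}$; its lines are the sets $\ell(\alpha,\beta):=\{U^{(\lambda_k\alpha+\beta,1)}\mid k\in K\}$ with $\alpha,\beta\in\mathrm{End}(U)$, $\alpha\ne0$. The line $\ell(\alpha,\beta)$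 is called regular if $\alpha$ is invertible. The standard regulus is $\mathcal R_0:=\{W\}\cup\{U^{(\lambda_k,1)}\mid k\in K\}$. A regulus in $\mathbb P(K,V)$ is an image of $\mathcal R_0$ under a projective collineation of $\mathbb P(K,V)$, i.e. under an element of $\mathrm{Aut}(V)$. An affine regulus (with respect to $W$) is a set $\mathcal R\setminus\{W\}$, where $\mathcal R$ is a regulus containing $W$. *)

(* Defs.v *)
From HB Require Import structures.
From mathcomp Require Import all_boot all_order all_algebra.
From mathcomp Require Import boolp classical_sets.

Set Implicit Arguments.
Unset Strict Implicit.
Unset Printing Implicit Defensive.

Import GRing.Theory.
Local Open Scope ring_scope.
Local Open Scope classical_set_scope.

(* Linear maps are applied on the left here, so a product written as an
   exponent (composed from left to right), such as u^(x y), is y (x u).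
   MathComp has no structure of division rings: one is a unitRingType K with
   GRing.field_axiom K, which does not include commutativity. *)

Section Basis.
Variables (K : unitRingType) (U : lmodType K) (I : eqType).

Definition is_basis (b : I -> U) : Prop :=
  (forall (s : seq I) (c : I -> K), uniq s ->
     \sum_(i <- s) c i *: b i = 0 -> forall i, i \in s -> c i = 0) /\
  (forall u : U, exists (s : seq I) (c : I -> K),
     uniq s /\ u = \sum_(i <- s) c i *: b i).

Variables (b : I -> U) (hb : is_basis b).

Let vanish_off (s : seq I) (c : I -> K) := forall i, i \notin s -> c i = 0.

Lemma basis_sum_widen (d : I -> U) (s t : seq I) (c : I -> K) :
  uniq s -> uniq t -> {subset s <= t} -> vanish_off s c ->
  \sum_(i <- t) c i *: d i = \sum_(i <- s) c i *: d i.
Proof.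
move=> us ut st cs; rewrite (bigID (mem s)) /= [X in _ + X]big1 ?addr0; last first.
  by move=> i /cs ->; rewrite scale0r.
rewrite -big_filter; apply: perm_big; apply: uniq_perm => //.
  exact: filter_uniq.
move=> i; rewrite mem_filter; apply/andP/idP => [[] //|is_].
by split=> //; apply: st.
Qed.

Lemma basis_span (u : U) : exists (s : seq I) (c : I -> K),
  [/\ uniq s, vanish_off s c & u = \sum_(i <- s) c i *: b i].
Proof.
have [s [c [us ->]]] := hb.2 u.
exists s, (fun i => if i \in s then c i else 0); split=> //.
  by move=> i /negbTE ->.
by apply: eq_big_seq => i ->.
Qed.

(* The basis extends to a linear map by prescribing the images d i. *)
Lemma basis_extend (d : I -> U) :
  exists f : {linear U -> U}, forall i, f (b i) = d i.
Proof.
pose P u v := exists (s : seq I) (c : I -> K),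
  [/\ uniq s, vanish_off s c, u = \sum_(i <- s) c i *: b i
    & v = \sum_(i <- s) c i *: d i].
have Pex u : exists v, P u v.
  by have [s [c [us cs ->]]] := basis_span u; exists (\sum_(i <- s) c i *: d i), s, c.
have Plin a u v u' v' : P u v -> P u' v' -> P (a *: u + u') (a *: v + v').
  move=> [s [c [us cs -> ->]]] [s' [c' [us' cs' -> ->]]].
  pose t := undup (s ++ s'); have ut : uniq t by exact: undup_uniq.
  have st : {subset s <= t} by move=> i is_; rewrite mem_undup mem_cat is_.
  have s't : {subset s' <= t}.
    by move=> i is_; rewrite mem_undup mem_cat is_ orbT.
  exists t, (fun i => a * c i + c' i); split=> //.
  - move=> i; rewrite mem_undup mem_cat negb_or => /andP[/cs -> /cs' ->].
    by rewrite mulr0 addr0.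
  - rewrite -(basis_sum_widen b us ut st cs) -(basis_sum_widen b us' ut s't cs').
    rewrite scaler_sumr -big_split; apply: eq_bigr => i _ /=.
    by rewrite scalerA scalerDl.
  - rewrite -(basis_sum_widen d us ut st cs) -(basis_sum_widen d us' ut s't cs').
    rewrite scaler_sumr -big_split; apply: eq_bigr => i _ /=.
    by rewrite scalerA scalerDl.
have P0 v : P 0 v -> v = 0.
  move=> [s [c [us _ /esym e ->]]]; rewrite big_seq big1 // => i is_.
  by rewrite (hb.1 s c us e i is_) scale0r.
have Puniq u v v' : P u v -> P u v' -> v = v'.
  move=> Pv Pv'; have := Plin (-1) _ _ _ _ Pv Pv'.
  rewrite !scaleN1r addNr => /P0 /eqP.
  by rewrite addrC subr_eq0 => /eqP.
have [f Pf] := choice Pex.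
have lf : linear f.
  by move=> a u v; apply: (Puniq (a *: u + v)) => //; exact: Plin.
pose F : {linear U -> U} := HB.pack f (GRing.isLinear.Build K U U _ f lf).
exists F => i; apply: (Puniq (b i)); first exact: Pf.
exists [:: i], (fun j => if j == i then 1 else 0); split=> //.
- by move=> j; rewrite inE => /negbTE ->.
- by rewrite big_seq1 eqxx scale1r.
- by rewrite big_seq1 eqxx scale1r.
Qed.

(* lambda k is the K-linear map with b i |-> k *: b i; it is not u |-> k *: u,
   which is not linear unless k is central in K. *)
Definition lambda (k : K) : {linear U -> U} :=
  projT1 (cid (basis_extend (fun i => k *: b i))).

Lemma lambdaE (k : K) (i : I) : lambda k (b i) = k *: b i.
Proof. exact: (projT2 (cid (basis_extend (fun i => k *: b i)))) i. Qed.

End Basis.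

(* Subspaces of V = U * U are represented by their sets of vectors. *)
Section Reguli.
Variables (K : unitRingType) (U : lmodType K).

Definition W : set (U * U) := [set: U] `*` [set 0].

(* U^(gamma,1) *)
Definition graph (gamma : U -> U) : set (U * U) :=
  range (fun u => (gamma u, u)).

(* Action on sets of subspaces of the collineation induced by phi. *)
Definition collineation_image (phi : {linear (U * U)%type -> (U * U)%type})
    (X : set (set (U * U))) : set (set (U * U)) :=
  [set phi @` S | S in X].

Variables (I : eqType) (b : I -> U) (hb : is_basis b).

(* l(alpha,beta): the affine lines are those with alpha <> 0; the line is
   regular when alpha is invertible, i.e. bijective. *)
Definition line (alpha beta : {linear U -> U}) : set (set (U * U)) :=
  [set graph (fun u => alpha (lambda hb k u) + beta u) | k in [set: K]].

Definition standard_regulus : set (set (U * U)) :=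
  [set W] `|` [set graph (lambda hb k) | k in [set: K]].

Definition regulus (R : set (set (U * U))) : Prop :=
  exists phi : {linear (U * U)%type -> (U * U)%type},
    bijective phi /\ R = collineation_image phi standard_regulus.

Definition affine_regulus (A : set (set (U * U))) : Prop :=
  exists R, [/\ regulus R, R W & A = R `\ W].

End Reguli.

(* Main.v *)
Require Import Defs.
From HB Require Import structures.
From mathcomp Require Import all_boot all_order all_algebra.
From mathcomp Require Import boolp classical_sets.

(** For [alpha] bijective, the map (w, u) |-> (alpha w + beta u, u) is a linear
    bijection of U * U which maps W onto itself and the graph of [lambda k]
    onto the graph of [alpha \o lambda k + beta]
    ([collineation_image_shear]).  Hence it takes the standard regulus without
    W to the line, and the standard regulus itself to a regulus through W.

    Conversely, any two distinct members of a regulus are complementary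
    ([regulus_complementary]).  This property is preserved by collineations,
    and in the standard regulus it comes down to the two facts that W is
    complementary to every graph, and that the graphs of two linear maps f and
    g are complementary exactly when f - g is bijective
    ([complementary_graph]): for f = lambda k and g = lambda l with k != l this
    difference is lambda (k - l), which is invertible because k - l is.  The
    line of [alpha] and [beta] contains the graphs of alpha + beta and of beta,
    at k = 1 and k = 0, and they differ when alpha != 0.  So if the line is part
    of a regulus, these graphs are complementary, and by the same criterion
    their difference alpha is bijective. *)

Set Implicit Arguments.
Unset Strict Implicit.
Unset Printing Implicit Defensive.

Import GRing.Theory.
Local Open Scope ring_scope.
Local Open Scope classical_set_scope.

Lemma inj_surj_bij (A B : Type) (f : A -> B) :
  injective f -> (forall y, exists x, f x = y) -> bijective f.
Proof.
move=> fI /choice[g fgK]; exists g; last exact: fgK.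
by move=> x; apply: fI; rewrite fgK.
Qed.

Lemma image_set_inj (A B : Type) (f : A -> B) :
  injective f -> injective (fun S : set A => f @` S).
Proof.
move=> fI S T /= e; apply: funext => a.
by rewrite -(image_inj (A := S) fI) e image_inj.
Qed.

Section Lambda.
Variables (K : unitRingType) (U : lmodType K) (I : eqType).
Variables (b : I -> U) (hb : is_basis b).

Lemma linear_eq_on_basis (f g : {linear U -> U}) :
  (forall i, f (b i) = g (b i)) -> f =1 g.
Proof.
move=> fg u; have [s [c [_ ->]]] := hb.2 u.
by rewrite !linear_sum; apply: eq_bigr => i _; rewrite !linearZ /= fg.
Qed.

Lemma lambda0 : lambda hb 0 =1 \0.
Proof. by apply: linear_eq_on_basis => i; rewrite lambdaE scale0r. Qed.

Lemma lambda1 : lambda hb 1 =1 idfun.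
Proof. by apply: linear_eq_on_basis => i; rewrite lambdaE scale1r. Qed.

Lemma lambdaB k l : lambda hb (k - l) =1 lambda hb k \- lambda hb l.
Proof. by apply: linear_eq_on_basis => i; rewrite /= !lambdaE scalerBl. Qed.

(** The factors are exchanged: lambda k is linear, so it leaves the coefficient
    l on the left of the image k *: b i. *)
Lemma lambdaM k l : lambda hb (l * k) =1 lambda hb k \o lambda hb l.
Proof.
by apply: linear_eq_on_basis => i; rewrite /= !lambdaE linearZ /= lambdaE scalerA.
Qed.

Lemma lambda_bij k : k \is a GRing.unit -> bijective (lambda hb k).
Proof.
move=> uk; exists (lambda hb k^-1) => u.
  by have /= <- := lambdaM k^-1 k u; rewrite mulrV // lambda1.
by have /= <- := lambdaM k k^-1 u; rewrite mulVr // lambda1.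
Qed.

End Lambda.

Section Complementary.
Variables (K : unitRingType).

Definition complementary (V : lmodType K) (S T : set V) : Prop :=
  S `&` T `<=` [set 0] /\
  forall x, exists s t, [/\ S s, T t & x = s + t].

Lemma complementary_sym (V : lmodType K) (S T : set V) :
  complementary S T -> complementary T S.
Proof.
move=> [ST0 ST]; split; first by rewrite setIC.
by move=> x; have [s [t [Ss Tt ->]]] := ST x; exists t, s; rewrite addrC.
Qed.

Lemma complementary_image (V : lmodType K) (phi : {linear V -> V})
    (S T : set V) :
  bijective phi -> complementary S T -> complementary (phi @` S) (phi @` T).
Proof.
move=> phib [ST0 ST]; split.
  move=> _ [[s Ss <-] [t Tt /(bij_inj phib) ets]] /=.
  by rewrite (ST0 s) ?linear0 //; split=> //; rewrite -ets.
move=> x; have [psi _ psiK] := phib; have [s [t [Ss Tt e]]] := ST (psi x).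
exists (phi s), (phi t); split; [by exists s|by exists t|].
by rewrite -linearD -e psiK.
Qed.

Variable U : lmodType K.

Lemma complementary_W_graph (f : {linear U -> U}) :
  complementary (@W K U) (graph f).
Proof.
split.
  by move=> x [Wx [u _ ux]]; move: Wx; rewrite -ux => -[_ /= ->]; rewrite linear0.
move=> [w u]; exists (w - f u, 0), (f u, u); split; [by []|by exists u|].
by congr pair => /=; rewrite ?subrK ?add0r.
Qed.

(** A common vector of the two graphs is a vector (f u, u) with f u = g u, so
    trivial intersection is injectivity of f - g.  A sum of a vector over u and
    a vector over - u is (f u - g u, 0), so the graphs span the vectors (w, 0),
    hence everything, exactly when f - g is surjective. *)
Lemma complementary_graph (f g : {linear U -> U}) :
  complementary (graph f) (graph g) <-> bijective (f \- g).
Proof.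
split=> [[fg0 fg]|fgb].
  apply: inj_surj_bij.
    apply: raddf_inj => u /= /subr0_eq efg.
    suff [] : (f u, u) = 0 by [].
    by apply: fg0; split; [exists u|exists u; rewrite ?efg].
  move=> w; have [_ [_ [[u _ <-] [v _ <-] [-> /esym/eqP]]]] := fg (w, 0).
  rewrite addrC addr_eq0 => /eqP ->; exists u.
  by rewrite /= linearN.
have [h _ hK] := fgb; split.
  move=> _ [[u _ <-] [v _ [/[swap] -> gf]]] /=.
  suff -> : u = 0 by rewrite linear0.
  by apply: (bij_inj fgb); rewrite /= gf subrr !linear0 addr0.
(* The component v over which f is taken has to satisfy
   f v + g (u - v) = w. *)
move=> [w u]; pose v := h (w - g u).
exists (f v, v), (g (u - v), u - v); split; [by exists v|by exists (u - v)|].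
have fgv : f v - g v = w - g u by exact: hK.
congr pair => /=; last by rewrite addrC subrK.
by rewrite linearB addrCA fgv addrC subrK.
Qed.

End Complementary.

Section Regulus.
Variables (K : unitRingType) (hK : GRing.field_axiom K).
Variables (U : lmodType K) (I : eqType) (b : I -> U) (hb : is_basis b).

Lemma standard_regulus_complementary (S T : set (U * U)) :
  standard_regulus hb S -> standard_regulus hb T -> S <> T ->
  complementary S T.
Proof.
move=> [->|[k _ <-]] [->|[l _ <-]] // ne.
- exact: complementary_W_graph.
- exact/complementary_sym/complementary_W_graph.
apply/complementary_graph; rewrite -(funext (lambdaB hb k l)).
apply: lambda_bij; apply: hK; rewrite subr_eq0.
by apply/eqP => kl; apply: ne; rewrite kl.
Qed.

Lemma regulus_complementary (R : set (set (U * U))) (S T : set (U * U)) :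
  regulus hb R -> R S -> R T -> S <> T -> complementary S T.
Proof.
move=> [phi [phib ->]] [S' RS' <-] [T' RT' <-] ne.
apply: complementary_image => //.
by apply: standard_regulus_complementary => // e; apply: ne; rewrite e.
Qed.

Lemma affine_regulus_line_bij (alpha beta : {linear U -> U}) :
  alpha <> \0 :> (U -> U) -> affine_regulus hb (line hb alpha beta) ->
  bijective alpha.
Proof.
move=> alpha0 [R [regR _ lineR]].
have sub_R S : line hb alpha beta S -> R S by rewrite lineR => -[].
have R1 : R (graph (alpha \+ beta)).
  apply: sub_R; exists 1 => //; congr graph.
  by apply: funext => u; rewrite lambda1.
have R0 : R (graph beta).
  apply: sub_R; exists 0 => //; congr graph.
  by apply: funext => u; rewrite lambda0 /= linear0 add0r.
have alphaE : (alpha \+ beta) \- beta = alpha :> (U -> U).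
  by apply: funext => u; rewrite /= addrK.
rewrite -alphaE; apply/complementary_graph.
apply: (regulus_complementary regR) => // eg; apply: alpha0.
apply: funext => u /=.
have : graph beta (alpha u + beta u, u) by rewrite -eg; exists u.
by move=> [v _ [/[swap] ->]] /esym/eqP; rewrite -subr_eq0 addrK => /eqP.
Qed.

End Regulus.

Section Shear.
Variables (K : unitRingType) (U : lmodType K).

Definition shear (alpha beta : U -> U) (x : U * U) : U * U :=
  (alpha x.1 + beta x.2, x.2).

Lemma shear_linear (alpha beta : {linear U -> U}) : linear (shear alpha beta).
Proof.
move=> a [w u] [w' u']; congr pair.
by rewrite /= !linearP scalerDr addrACA.
Qed.

HB.instance Definition _ (alpha beta : {linear U -> U}) :=
  GRing.isLinear.Build K (U * U)%type (U * U)%type _ (shear alpha beta)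
    (shear_linear alpha beta).

Lemma shear_bij (alpha beta : {linear U -> U}) :
  bijective alpha -> bijective (shear alpha beta).
Proof.
move=> [g gK Kg]; exists (fun x => (g (x.1 - beta x.2), x.2)) => -[w u].
  by rewrite /shear /= addrK gK.
by rewrite /shear /= Kg subrK.
Qed.

Lemma shear_W (alpha beta : {linear U -> U}) :
  bijective alpha -> shear alpha beta @` @W K U = @W K U.
Proof.
move=> [g _ Kg]; apply/seteqP; split=> [_ [[w u] [_ /= u0] <-]|[w u] [_ /= ->]].
  by split.
exists (g w, 0); first by split.
by rewrite /shear /= Kg linear0 addr0.
Qed.

Lemma shear_graph (alpha beta : {linear U -> U}) (f : U -> U) :
  shear alpha beta @` graph f = graph (fun u => alpha (f u) + beta u).
Proof. by rewrite /graph image_comp. Qed.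

Lemma W_neq_graph (f : U -> U) :
  (exists u : U, u != 0) -> f 0 = 0 -> graph f <> @W K U.
Proof.
move=> [u u0] f0 eW.
have : graph f (u, 0) by rewrite eW; split.
by move=> [v _ [/[swap] ->]]; rewrite f0 => /esym/eqP; rewrite (negPf u0).
Qed.

Lemma collineation_imageD1 (phi : {linear (U * U)%type -> (U * U)%type})
    (X : set (set (U * U))) (S : set (U * U)) :
  bijective phi ->
  collineation_image phi (X `\ S) = collineation_image phi X `\ (phi @` S).
Proof.
move=> phib; apply/seteqP; split=> [_ [T [XT TS] <-]|_ [[T XT <-] TS]].
  by split; [exists T|move=> /(image_set_inj (bij_inj phib))].
by exists T => //; split=> // e; apply: TS; rewrite e.
Qed.

Variables (I : eqType) (b : I -> U) (hb : is_basis b).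

Lemma collineation_image_shear (alpha beta : {linear U -> U}) :
  (exists u : U, u != 0) ->
  collineation_image (shear alpha beta) (standard_regulus hb `\ @W K U) =
  line hb alpha beta.
Proof.
move=> hU; apply/seteqP; split=> [_ [S [RS neW] <-]|_ [k _ <-]].
  by case: RS => [//|[k _ <-]]; exists k => //; rewrite shear_graph.
exists (graph (lambda hb k)); last by rewrite shear_graph.
split; first by right; exists k.
by apply: W_neq_graph => //; rewrite linear0.
Qed.

Lemma line_affine_regulus (alpha beta : {linear U -> U}) :
  (exists u : U, u != 0) -> bijective alpha ->
  affine_regulus hb (line hb alpha beta).
Proof.
move=> hU alphab.
exists (collineation_image (shear alpha beta) (standard_regulus hb)); split.
- by exists (shear alpha beta); split=> //; exact: shear_bij.
- by exists (@W K U); [left|exact: shear_W].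
- rewrite -collineation_image_shear // collineation_imageD1 ?shear_W //.
  exact: shear_bij.
Qed.

End Shear.

Theorem proposition3p1 (K : unitRingType) (hK : GRing.field_axiom K)
  (U : lmodType K) (hU : exists u : U, u != 0)
  (I : eqType) (b : I -> U) (hb : is_basis b) :
  (forall alpha beta : {linear U -> U}, alpha <> \0 :> (U -> U) ->
     bijective alpha <-> affine_regulus hb (line hb alpha beta)) /\
  (forall alpha beta : {linear U -> U}, bijective alpha ->
     exists phi : {linear (U * U)%type -> (U * U)%type},
       [/\ bijective phi,
           forall w u : U, phi (w, u) = (alpha w + beta u, u)
         & line hb alpha beta =
             collineation_image phi (standard_regulus hb `\ @W K U)]).
Proof.
split=> alpha beta.
  move=> alpha0; split; first exact: line_affine_regulus.
  exact: affine_regulus_line_bij.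
move=> alphab; exists (shear alpha beta); split=> //; first exact: shear_bij.
by rewrite collineation_image_shear.
Qed.
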